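(* Let $\mathbb{F}_q$ be a finite field of odd characteristic and let $\epsilon,\delta\in\mathbb{F}_q$ with $\epsilon(\delta^2-\epsilon)\neq 0$, where $\epsilon$ is a square in $\mathbb{F}_q$ with a fixed square root $\sqrt{\epsilon}\in\mathbb{F}_q$, and assume $\chi\big(2\sqrt{\epsilon}(\sqrt{\epsilon}-\delta)\big)=1$. Fix a square root $\sqrt{2\sqrt{\epsilon}(\sqrt{\epsilon}-\delta)}\in\mathbb{F}_q$. Then the Jacobi quartic curve $J_{\epsilon,\delta}: y^2=\epsilon x^4+2\delta x^2+1$ over $\mathbb{F}_q$ has dADD-M formulas with the function $$w(x,y)=2\sqrt{2\sqrt{\epsilon}(\sqrt{\epsilon}-\delta)}\;\left(\frac{x}{1+\sqrt{\epsilon}\,x^2}\right)^2$$ and $$e=\frac{\left(2\sqrt{\epsilon}+\sqrt{2\sqrt{\epsilon}(\sqrt{\epsilon}-\delta)}\right)^2}{2\sqrt{\epsilon}\,\sqrt{2\sqrt{\epsilon}(\sqrt{\epsilon}-\delta)}};$$ that is, $w$ is an inverted Montgomery-like function on $J_{\epsilon,\delta}$ with parameter $e$.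
   Context: $\chi$ is the quadratic character of $\mathbb{F}_q$: for $a\ne0$, $\chi(a)=1$ if $a$ is a square in $\mathbb{F}_q$ and $\chi(a)=-1$ otherwise. The Jacobi quartic curve $J_{\epsilon,\delta}$ is regarded as an elliptic curve through its smooth projective model $X^2=TZ$, $Y^2=\epsilon T^2+2\delta X^2+Z^2$ in $\mathbb{P}^3$ with coordinates $(X:Y:T:Z)$, the affine point $(x,y)$ being $(x:y:x^2:1)$; the points with $Z=0$ are $(0:\pm\sqrt{\epsilon}:1:0)$. The identity is $(0,1)$, $-(x,y)=(-x,y)$, and addition is generically $$(x_1,y_1)+(x_2,y_2)=\left(\frac{x_1y_2+x_2y_1}{1-\epsilon x_1^2x_2^2},\ \frac{(y_1y_2+2\delta x_1x_2)(1+\epsilon x_1^2x_2^2)+2\epsilon x_1x_2(x_1^2+x_2^2)}{(1-\epsilon x_1^2x_2^2)^2}\right).$$ Inverted Montgomery-like function: let $E$ be an elliptic curve over a field $\mathbb{F}$ of characteristic $\neq2$ and $w$ a rational function on $E$ with $w(P)=w(-P)$ for all $P$. View $w(P)$ in $\mathbb{P}^1(\mathbb{F})$ as $(w(P):1)$ if $w$ is regular at $P$ and $(1:0)$ otherwise. For $P_1,P_2\in E(\mathbb{F})$ put $(W_0:Z_0)=w(P_2-P_1)$, $(W_1:Z_1)=w(P_1)$, $(W_2:Z_2)=w(P_2)$, $(W_3:Z_3)=w(P_1+P_2)$, $(W_4:Z_4)=w(2P_1)$. Then $w$ is an inverted Montgomery-like function with parameter $e\in\mathbb{F}$ if for all $P_1,P_2\in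 E(\mathbb{F})$ with $W_0Z_0\neq0$, $$(W_4:Z_4)=\big(4W_1Z_1((W_1+Z_1)^2-eW_1Z_1):(W_1^2-Z_1^2)^2\big),$$ $$(W_3:Z_3)=\big(Z_0(W_1Z_2-W_2Z_1)^2:W_0(W_1W_2-Z_1Z_2)^2\big).$$ (Equivalently $1/w$ is a Montgomery-like function, given by the same formulas with the two coordinates swapped; a curve with such a function is said to have dADD-M formulas.) *)

(* Defs.v *)
From HB Require Import structures.
From mathcomp Require Import all_boot all_order all_algebra.
From mathcomp Require Import ring boolp.
From mathcomp.multinomials Require Import mpoly.

Set Implicit Arguments.
Unset Strict Implicit.
Unset Printing Implicit Defensive.

Import GRing.Theory.
Local Open Scope ring_scope.

Definition quad_char (F : finFieldType) (a : F) : int :=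
  if a == 0 then 0 else if [exists b : F, b ^+ 2 == a] then 1 else -1.

(* Equality in P^1 of the classes of two pairs.  If one side is nonzero, so is
   the other: (0, 0) is only related to itself. *)
Definition P1_eq (F : fieldType) (u v : F * F) : Prop :=
  exists2 k : F, k != 0 & u = (k * v.1, k * v.2).

(* Points of P^3 are given by homogeneous coordinates, in the order
   (X : Y : T : Z). *)
Definition P3_eq (F : fieldType) (P Q : 4.-tuple F) : Prop :=
  exists2 k : F, k != 0 & forall i, tnth P i = k * tnth Q i.

Definition mk4 (F : fieldType) (X Y T Z : F) : 4.-tuple F := [tuple X; Y; T; Z].

Section JacobiQuartic.
Variables (F : fieldType) (eps delta : F).

Definition on_curve (P : 4.-tuple F) : bool :=
  let: (X, Y, T, Z) := (P`_0, P`_1, P`_2, P`_3) in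
  [&& P != mk4 0 0 0 0, X ^+ 2 == T * Z &
      Y ^+ 2 == eps * T ^+ 2 + 2%:R * delta * X ^+ 2 + Z ^+ 2].

Definition affine_pt (x y : F) : 4.-tuple F := mk4 x y (x ^+ 2) 1.

Definition jq_zero : 4.-tuple F := affine_pt 0 1.

Definition jq_opp (P : 4.-tuple F) : 4.-tuple F := mk4 (- P`_0) P`_1 P`_2 P`_3.

(* The generic affine addition formula, homogenized. *)
Definition add_law1 (P Q : 4.-tuple F) : 4.-tuple F :=
  let: (X1, Y1, T1, Z1) := (P`_0, P`_1, P`_2, P`_3) in
  let: (X2, Y2, T2, Z2) := (Q`_0, Q`_1, Q`_2, Q`_3) in
  let a := X1 * Y2 + X2 * Y1 in
  let b := Z1 * Z2 - eps * T1 * T2 in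
  mk4 (a * b)
      ((Y1 * Y2 + 2%:R * delta * X1 * X2) * (Z1 * Z2 + eps * T1 * T2)
       + 2%:R * eps * X1 * X2 * (T1 * Z2 + Z1 * T2))
      (a ^+ 2) (b ^+ 2).

(* A second expression of the same map, obtained from
   (x1 y2 + x2 y1) (x1 y2 - x2 y1) = (x1^2 - x2^2) (1 - eps x1^2 x2^2). *)
Definition add_law2 (P Q : 4.-tuple F) : 4.-tuple F :=
  let: (X1, Y1, T1, Z1) := (P`_0, P`_1, P`_2, P`_3) in
  let: (X2, Y2, T2, Z2) := (Q`_0, Q`_1, Q`_2, Q`_3) in
  let c := T1 * Z2 - T2 * Z1 in
  let d := X1 * Y2 - X2 * Y1 in
  mk4 (c * d)
      ((T1 * Z2 + T2 * Z1) * (Y1 * Y2 - 2%:R * delta * X1 * X2)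
       - 2%:R * X1 * X2 * (Z1 * Z2 + eps * T1 * T2))
      (c ^+ 2) (d ^+ 2).

(* The two laws agree wherever both are defined (add_laws_agree) and at least
   one is defined at every pair of points (add_laws_complete), so jq_add is the
   morphism E x E -> E that extends the generic addition formula
   (jq_add_affine), i.e. the group law of the elliptic curve. *)
Definition jq_add (P Q : 4.-tuple F) : 4.-tuple F :=
  if add_law1 P Q != mk4 0 0 0 0 then add_law1 P Q else add_law2 P Q.

Definition cX : {mpoly F[4]} := 'X_(inord 0).
Definition cY : {mpoly F[4]} := 'X_(inord 1).
Definition cT : {mpoly F[4]} := 'X_(inord 2).
Definition cZ : {mpoly F[4]} := 'X_(inord 3).

(* The homogeneous ideal of the curve. *)
Definition in_ideal (p : {mpoly F[4]}) : Prop :=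
  exists u v : {mpoly F[4]},
    p = u * (cX ^+ 2 - cT * cZ)
      + v * (cY ^+ 2
             - (eps *: cT ^+ 2 + (2%:R * delta) *: cX ^+ 2 + cZ ^+ 2)).

(* Rational functions on the curve: quotients of two forms of the same degree,
   the denominator not vanishing identically on the curve.  Equality in the
   function field is ratfun_eq. *)
Record ratfun := RatFun {
  rf_num : {mpoly F[4]};
  rf_den : {mpoly F[4]};
  rf_homog : exists d : nat, rf_num \is d.-homog /\ rf_den \is d.-homog;
  rf_den_neq0 : ~ in_ideal rf_den }.

Definition ratfun_eq (f g : ratfun) : Prop :=
  in_ideal (rf_num f * rf_den g - rf_num g * rf_den f).

(* f is regular at P with value r. *)
Definition regular_value (f : ratfun) (P : 4.-tuple F) (r : F) : Prop :=
  exists g : ratfun,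
    [/\ ratfun_eq f g, (rf_den g).@[tnth P] != 0
      & r = (rf_num g).@[tnth P] / (rf_den g).@[tnth P]].

(* The value of f at P in P^1. *)
Definition P1_value (f : ratfun) (P : 4.-tuple F) : F * F :=
  match pselect (exists r : F, regular_value f P r) with
  | left h => (projT1 (cid h), 1)
  | right _ => (1, 0)
  end.

Definition opp_subst (p : {mpoly F[4]}) : {mpoly F[4]} :=
  p \mPo [tuple - cX; cY; cT; cZ].

(* w \o [-1] = w in the function field. *)
Definition ratfun_even (w : ratfun) : Prop :=
  in_ideal (rf_num w * opp_subst (rf_den w) - opp_subst (rf_num w) * rf_den w).

Definition inverted_Montgomery_like (w : ratfun) (e : F) : Prop :=
  ratfun_even w /\
  forall P1 P2 : 4.-tuple F, on_curve P1 -> on_curve P2 ->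
    let: (W0, Z0) := P1_value w (jq_add P2 (jq_opp P1)) in
    let: (W1, Z1) := P1_value w P1 in
    let: (W2, Z2) := P1_value w P2 in
    let: (W3, Z3) := P1_value w (jq_add P1 P2) in
    let: (W4, Z4) := P1_value w (jq_add P1 P1) in
    W0 * Z0 != 0 ->
    P1_eq (W4, Z4)
      (4%:R * W1 * Z1 * ((W1 + Z1) ^+ 2 - e * W1 * Z1),
       (W1 ^+ 2 - Z1 ^+ 2) ^+ 2) /\
    P1_eq (W3, Z3)
      (Z0 * (W1 * Z2 - W2 * Z1) ^+ 2, W0 * (W1 * W2 - Z1 * Z2) ^+ 2).

(* 2 s (x / (1 + a x^2))^2 with x = X / Z. *)
Definition jq_w_num (s : F) : {mpoly F[4]} := (2%:R * s) *: (cX * cZ) ^+ 2.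
Definition jq_w_den (a : F) : {mpoly F[4]} := (cZ ^+ 2 + a *: cX ^+ 2) ^+ 2.

Lemma jq_w_homog (a s : F) :
  exists d : nat, jq_w_num s \is d.-homog /\ jq_w_den a \is d.-homog.
Proof.
have hX (i : 'I_4) : ('X_i : {mpoly F[4]}) \is 1.-homog.
  by rewrite dhomogX /= mdeg1.
have sq d (p : {mpoly F[4]}) : p \is d.-homog -> p ^+ 2 \is (d + d).-homog.
  by move=> h; rewrite expr2 dhomogM.
exists 4; split.
  by apply: rpredZ; apply: (sq 2); apply: (dhomogM (d := 1) (e := 1)); apply: hX.
by apply: (sq 2); apply: rpredD; [|apply: rpredZ]; apply: (sq 1); apply: hX.
Qed.

Lemma coord_eval (P : 4.-tuple F) :
  (cX.@[tnth P] = P`_0) * (cY.@[tnth P] = P`_1)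
  * (cT.@[tnth P] = P`_2) * (cZ.@[tnth P] = P`_3).
Proof. by rewrite !mevalXU !(tnth_nth 0) !inordK. Qed.

Lemma in_ideal_eval (p : {mpoly F[4]}) (P : 4.-tuple F) :
  on_curve P -> in_ideal p -> p.@[tnth P] = 0.
Proof.
move=> /and3P [_ /eqP hX /eqP hY] [u [v ->]].
rewrite !(mevalD, mevalM, mevalB, mevalN, mevalZ, rmorphXn) /= -!expr2.
by rewrite !coord_eval hX hY; ring: hX.
Qed.

Lemma jq_zero_on_curve : on_curve jq_zero.
Proof.
apply/and3P; split=> /=.
- by apply/eqP => /(congr1 (fun P : 4.-tuple F => P`_1)) /eqP; rewrite oner_eq0.
- by apply/eqP; ring.
- by apply/eqP; ring.
Qed.

Lemma jq_w_den_neq0 (a : F) : ~ in_ideal (jq_w_den a).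
Proof.
move=> /(in_ideal_eval jq_zero_on_curve) /eqP.
rewrite !(mevalD, mevalM, mevalZ, rmorphXn) /= !coord_eval /=.
by rewrite !mulr0 addr0 !mulr1 oner_eq0.
Qed.

Definition jq_w (a s : F) : ratfun :=
  RatFun (jq_w_homog a s) (@jq_w_den_neq0 a).

End JacobiQuartic.

Section GroupLaw.
Variables (F : fieldType) (eps delta : F).
Hypotheses (two_neq0 : 2%:R != 0 :> F)
           (nonsing : eps * (delta ^+ 2 - eps) != 0).
Implicit Types P Q : 4.-tuple F.

Local Notation on_curve := (on_curve eps delta).
Local Notation law1 := (add_law1 eps delta).
Local Notation law2 := (add_law2 eps delta).

Lemma add_laws_agree P Q : on_curve P -> on_curve Q ->
  forall i j : 'I_4,
    tnth (law1 P Q) i * tnth (law2 P Q) j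
    = tnth (law1 P Q) j * tnth (law2 P Q) i.
Proof.
move=> /and3P [_ /eqP hX1 /eqP hY1] /and3P [_ /eqP hX2 /eqP hY2].
move: hX1 hY1 hX2 hY2; rewrite /add_law1 /add_law2.
set X1 := P`_0; set Y1 := P`_1; set T1 := P`_2; set Z1 := P`_3.
set X2 := Q`_0; set Y2 := Q`_1; set T2 := Q`_2; set Z2 := Q`_3.
move=> hX1 hY1 hX2 hY2; rewrite hX1 in hY1; rewrite hX2 in hY2.
move=> [[|[|[|[|i]]]] hi] [[|[|[|[|j]]]] hj] //;
  rewrite !(tnth_nth 0) /=; by ring: hX1 hY1 hX2 hY2.
Qed.

Lemma mk4_eq0 (a b c d : F) :
  (mk4 a b c d == mk4 0 0 0 0) = [&& a == 0, b == 0, c == 0 & d == 0].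
Proof. by rewrite -val_eqE /= !eqseq_cons andbT. Qed.

Lemma on_curve_TZ P : on_curve P -> P`_2 = 0 -> P`_3 = 0 -> False.
Proof.
move=> /and3P [/eqP P0 /eqP hX /eqP hY] hT hZ; apply: P0.
move: hX; rewrite hT mul0r => /eqP; rewrite sqrf_eq0 => /eqP hX.
move: hY; rewrite hT hX hZ expr0n /= !mulr0 !addr0 => /eqP.
rewrite sqrf_eq0 => /eqP hY; apply: eq_from_tnth.
by move=> [[|[|[|[|i]]]] hi]; rewrite ?(tnth_nth 0) /= ?hX ?hY ?hT ?hZ.
Qed.

Lemma on_curve_XY P : on_curve P -> P`_0 = 0 -> P`_1 = 0 -> False.
Proof.
move=> cP hX hY; have /and3P [_ /eqP eX /eqP eY] := cP.
have /andP [e0 _] : (eps != 0) && (delta ^+ 2 - eps != 0).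
  by move: nonsing; rewrite mulf_eq0 negb_or.
move: eX eY; rewrite hX hY expr0n /= mulr0 addr0.
move=> /esym /eqP; rewrite mulf_eq0 => /orP [] /eqP h.
  rewrite h expr0n mulr0 add0r => /esym /eqP; rewrite sqrf_eq0 => /eqP.
  exact: on_curve_TZ.
rewrite h expr0n addr0 => /esym /eqP; rewrite mulf_eq0 (negPf e0) sqrf_eq0.
by move=> /eqP hT; apply: (on_curve_TZ cP).
Qed.

Lemma add_laws_complete P Q : on_curve P -> on_curve Q ->
  law1 P Q = mk4 0 0 0 0 -> law2 P Q = mk4 0 0 0 0 -> False.
Proof.
have /andP [e0 de] : (eps != 0) && (delta ^+ 2 - eps != 0).
  by move: nonsing; rewrite mulf_eq0 negb_or.
move=> cP cQ /eqP h1 /eqP h2; move: h1 h2.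
have := on_curve_TZ cP; have := on_curve_TZ cQ.
have := on_curve_XY cP; have := on_curve_XY cQ.
have /and3P [_ /eqP] := cP; have /and3P [_ /eqP] := cQ.
rewrite /add_law1 /add_law2.
set X1 := P`_0; set Y1 := P`_1; set T1 := P`_2; set Z1 := P`_3.
set X2 := Q`_0; set Y2 := Q`_1; set T2 := Q`_2; set Z2 := Q`_3.
rewrite !mk4_eq0 !sqrf_eq0.
move=> eX2 /eqP eY2 eX1 /eqP eY1 nXY2 nXY1 nTZ2 nTZ1.
move=> /and4P [_ _ /eqP a0 /eqP b0] /and4P [_ _ /eqP c0 /eqP d0].
have XY1 : X1 * Y2 = 0.
  have /eqP : 2%:R * (X1 * Y2) = 0.
    transitivity ((X1 * Y2 + X2 * Y1) + (X1 * Y2 - X2 * Y1)); first by ring.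
    by rewrite a0 d0 addr0.
  by rewrite mulf_eq0 (negPf two_neq0) => /eqP.
have XY2 : X2 * Y1 = 0 by rewrite -[LHS]add0r -{1}XY1.
have TZ : T1 * Z2 = T2 * Z1 by apply/eqP; rewrite -subr_eq0 c0.
have ZZ : Z1 * Z2 = eps * T1 * T2 by apply/eqP; rewrite -subr_eq0 b0.
have zero2 : (T1 == 0) || (Z1 == 0) -> False.
  move=> /orP [] /eqP h; move: TZ ZZ; rewrite h.
    have z0 : Z1 != 0 by apply/eqP => /(nTZ1 h).
    rewrite mul0r mulr0 mul0r => /esym /eqP.
    rewrite mulf_eq0 (negPf z0) orbF => /eqP t2 /eqP.
    by rewrite mulf_eq0 (negPf z0) => /eqP /(nTZ2 t2).
  have t0 : T1 != 0 by apply/eqP => /nTZ1 /(_ h).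
  rewrite mul0r mulr0 => /eqP; rewrite mulf_eq0 (negPf t0) => /eqP z2 /esym.
  by move=> /eqP; rewrite !mulf_eq0 (negPf e0) (negPf t0) => /eqP /nTZ2 /(_ z2).
move: XY1 => /eqP; rewrite mulf_eq0 => /orP [] /eqP h.
  apply: zero2; rewrite -mulf_eq0 -eX1 h; by rewrite expr0n.
move: XY2 => /eqP; rewrite mulf_eq0 => /orP [] /eqP h'; first exact: (nXY2 h').
have eZ : Z1 ^+ 2 = eps * T1 ^+ 2.
  have t2 : (T2 == 0) = false.
    apply/negP => /eqP t2; apply: nXY2 => //.
    by apply/eqP; rewrite -sqrf_eq0 eX2 t2 mul0r.
  apply/eqP; rewrite -subr_eq0 -(mulIr_eq0 _ (mulIf (negbT t2))); apply/eqP.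
  transitivity (Z1 * (T2 * Z1) - T1 * (eps * T1 * T2)); first by ring.
  by rewrite -TZ -ZZ; ring.
have t1 : T1 != 0 by apply/eqP => t; apply: zero2; rewrite t eqxx.
have z1 : Z1 != 0 by apply/eqP => z; apply: zero2; rewrite z eqxx orbT.
move: eY1; rewrite h' eX1 eZ expr0n /= => /esym eY1.
have eT : eps * T1 + delta * Z1 = 0.
  apply/eqP; rewrite -(mulIr_eq0 _ (mulIf t1)).
  rewrite -(mulIr_eq0 _ (mulIf two_neq0)); apply/eqP.
  rewrite -[RHS]eY1; ring.
have : (delta ^+ 2 - eps) * eps * T1 ^+ 2 == 0.
  apply/eqP; transitivity
    ((delta * Z1 - eps * T1) * (eps * T1 + delta * Z1)
     + delta ^+ 2 * (eps * T1 ^+ 2 - Z1 ^+ 2)); first by ring.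
  by rewrite eT eZ; ring.
by rewrite !mulf_eq0 (negPf de) (negPf e0) (negPf t1).
Qed.

Lemma jq_add_on_curve P Q :
  on_curve P -> on_curve Q -> on_curve (jq_add eps delta P Q).
Proof.
move=> cP cQ; apply/andP; split.
  rewrite /jq_add; case: ifP => // /negbFE /eqP h1; apply/eqP => h2.
  exact: add_laws_complete cP cQ h1 h2.
move: cP cQ => /and3P [_ /eqP hX1 /eqP hY1] /and3P [_ /eqP hX2 /eqP hY2].
move: hX1 hY1 hX2 hY2; rewrite /jq_add; case: ifP => _;
rewrite /add_law1 /add_law2 /=;
set X1 := P`_0; set Y1 := P`_1; set T1 := P`_2; set Z1 := P`_3;
set X2 := Q`_0; set Y2 := Q`_1; set T2 := Q`_2; set Z2 := Q`_3;
move=> hX1 hY1 hX2 hY2; rewrite hX1 in hY1; rewrite hX2 in hY2;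
by apply/andP; split; apply/eqP; ring: hX1 hY1 hX2 hY2.
Qed.

Lemma jq_add_affine (x1 y1 x2 y2 : F) :
  1 - eps * x1 ^+ 2 * x2 ^+ 2 != 0 ->
  P3_eq (jq_add eps delta (affine_pt x1 y1) (affine_pt x2 y2))
    (affine_pt
      ((x1 * y2 + x2 * y1) / (1 - eps * x1 ^+ 2 * x2 ^+ 2))
      (((y1 * y2 + 2%:R * delta * x1 * x2) * (1 + eps * x1 ^+ 2 * x2 ^+ 2)
        + 2%:R * eps * x1 * x2 * (x1 ^+ 2 + x2 ^+ 2))
       / (1 - eps * x1 ^+ 2 * x2 ^+ 2) ^+ 2)).
Proof.
move=> h; exists ((1 - eps * x1 ^+ 2 * x2 ^+ 2) ^+ 2).
  by rewrite expf_neq0.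
have -> : jq_add eps delta (affine_pt x1 y1) (affine_pt x2 y2)
        = law1 (affine_pt x1 y1) (affine_pt x2 y2).
  rewrite /jq_add ifT // /add_law1 /= mk4_eq0 !sqrf_eq0 mul1r (negPf h).
  by rewrite !andbF.
move=> [[|[|[|[|i]]]] hi] //; rewrite !(tnth_nth 0) /=; by field.
Qed.

Lemma jq_add0 P : on_curve P -> P3_eq (jq_add eps delta P (jq_zero F)) P.
Proof.
move=> cP; have nTZ := on_curve_TZ cP; move: cP => /and3P [_ /eqP hX _].
move: hX nTZ; rewrite /jq_add /add_law1 /add_law2 /= mk4_eq0 expr0n /=.
move=> hX nTZ; case: ifPn => [|/negPn /and4P [_ _ _]]; last first.
  rewrite expf_eq0 /= !(mulr1, mulr0, subr0) => /eqP z0.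
  exists P`_2; first by apply/eqP => /nTZ /(_ z0).
  rewrite z0 mulr0 in hX; have x0 : P`_0 = 0 by apply/eqP; rewrite -sqrf_eq0 hX.
  by move=> [[|[|[|[|i]]]] hi] //; rewrite !(tnth_nth 0) /= ?z0 ?x0; ring.
move=> nz; have z0 : P`_3 != 0.
  apply/eqP => z0; move: nz; rewrite z0 mulr0 in hX *.
  have x0 : P`_0 = 0 by apply/eqP; rewrite -sqrf_eq0 hX.
  by rewrite x0 !(mul0r, mulr0, mulr1, addr0, subr0, expr0n) /= eqxx.
exists P`_3 => // - [[|[|[|[|i]]]] hi] //; rewrite !(tnth_nth 0) /=; by ring: hX.
Qed.

Lemma jq_addN P : on_curve P ->
  P3_eq (jq_add eps delta P (jq_opp P)) (jq_zero F).
Proof.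
move=> cP; have := jq_add_on_curve cP.
have cN : on_curve (jq_opp P).
  move: cP => /and3P [P0 hX hY]; apply/and3P; split; rewrite //= ?sqrrN //.
  apply: contra P0 => /eqP /(congr1 val) [/eqP].
  rewrite oppr_eq0 => /eqP x0 y0 t0 z0; apply/eqP/eq_from_tnth.
  by move=> [[|[|[|[|i]]]] hi]; rewrite ?(tnth_nth 0).
move=> /(_ _ cN) /and3P [+ _ _]; move: cP => /and3P [_ /eqP hX /eqP hY].
rewrite hX in hY; rewrite /jq_add; case: ifPn => [nz _|_ nz].
  exists ((P`_3 ^+ 2 - eps * P`_2 ^+ 2) ^+ 2).
    apply: contra nz; rewrite sqrf_eq0 => /eqP h.
    rewrite mk4_eq0 /=; apply/and4P; split; apply/eqP; try by ring.
      transitivity ((P`_3 ^+ 2 - eps * P`_2 ^+ 2) ^+ 2); first by ring: hX hY.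
      by rewrite h expr0n.
    transitivity ((P`_3 ^+ 2 - eps * P`_2 ^+ 2) ^+ 2); first by ring.
    by rewrite h expr0n.
  move=> [[|[|[|[|i]]]] hi] //; rewrite !(tnth_nth 0) /=; by ring: hX hY.
exists (4%:R * P`_0 ^+ 2 * P`_1 ^+ 2).
  apply: contra nz => /eqP h; rewrite mk4_eq0 /=; apply/and4P.
  split; apply/eqP; try by ring.
    by rewrite -[RHS]h; ring: hX hY.
  by rewrite -[RHS]h; ring.
move=> [[|[|[|[|i]]]] hi] //; rewrite !(tnth_nth 0) /=; by ring: hX hY.
Qed.

End GroupLaw.

(* Main.v *)
Require Import Defs.
From HB Require Import structures.
From mathcomp Require Import all_boot all_order all_algebra.
From mathcomp Require Import ring boolp.
From mathcomp.multinomials Require Import mpoly.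

Set Implicit Arguments.
Unset Strict Implicit.

(** On the curve X^2 = TZ, so w = 2 s (XZ)^2 / (Z^2 + a X^2)^2 is also
    2 s X^2 / (Z + a T)^2.  The forms 2 s X^2 and (Z + a T)^2 have no common
    zero on the curve, so the value of w in P^1 at every point, including its
    poles and the two points with Z = 0, is (W : V) = (2 s X^2 : (Z + a T)^2)
    (P1_value_jq_w).  This reduces the theorem to polynomial identities in
    homogeneous coordinates.

    Doubling: on a point P the first addition law is always defined and
    substituting it in (W : V) gives the two doubling forms on the nose
    (w_coords_double); the parameter e enters through
    e s = 2 s + 3 a - delta.

    Differential addition: for points P, Q put
      A = X1 Y2 + X2 Y1,   b = Z1 Z2 - eps T1 T2,
      c = T1 Z2 - T2 Z1,   d = X1 Y2 - X2 Y1,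
    which satisfy A d = c b (law_x_z).  The x-coordinate X / Z of P + Q is A / b
    or c / d, and that of Q - P is - d / b or - c / A, depending on the addition
    law that applies.  The two quantities in the formula are
      W1 V2 - W2 V1 = 2 s c b                                (w_difference),
      V1 V2 - W1 W2 = b^2 + a (A^2 + d^2) + a^2 c^2          (w_product),
    and b^2 times the latter factors as (b^2 + a A^2) (b^2 + a d^2), the product
    of the square roots of the V-coordinates of P + Q and Q - P.  When b is
    nonzero this is the required formula; when b = 0, A or d vanishes, and
    w(Q - P) being neither 0 nor infinity leaves only A <> 0, d = 0, where
    w(P + Q) = 0 (w_coords_dadd). *)

Import GRing.Theory.
Local Open Scope ring_scope.

(** * The value of w in the projective line *)

Section Value.
Variables (F : fieldType) (eps delta a s : F).
Hypotheses (two_neq0 : 2%:R != 0 :> F) (a_neq0 : a != 0) (s_neq0 : s != 0)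
           (sqr_a : a ^+ 2 = eps).
Implicit Types P : 4.-tuple F.

(** Homogeneous coordinates of w, with no common zero on the curve; on the curve,
    the defining fraction of w is Z^2 / Z^2 times this one. *)
Definition w_coords (P : 4.-tuple F) : F * F :=
  (2%:R * s * P`_0 ^+ 2, (P`_3 + a * P`_2) ^+ 2).

Definition reduced_num : {mpoly F[4]} := (2%:R * s) *: cX F ^+ 2.
Definition reduced_den : {mpoly F[4]} := (cZ F + a *: cT F) ^+ 2.

Lemma reduced_homog :
  exists d : nat, reduced_num \is d.-homog /\ reduced_den \is d.-homog.
Proof.
have hX (i : 'I_4) : ('X_i : {mpoly F[4]}) \is 1.-homog.
  by rewrite dhomogX /= mdeg1.
have sq (p : {mpoly F[4]}) : p \is 1.-homog -> p ^+ 2 \is 2.-homog.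
  by move=> h; rewrite expr2; apply: (dhomogM (d := 1) (e := 1)).
exists 2; split; first by apply: rpredZ; apply: sq; apply: hX.
by apply: sq; apply: rpredD; [|apply: rpredZ]; apply: hX.
Qed.

Lemma reduced_num_eval P : reduced_num.@[tnth P] = 2%:R * s * P`_0 ^+ 2.
Proof. by rewrite mevalZ rmorphXn /= coord_eval. Qed.

Lemma reduced_den_eval P : reduced_den.@[tnth P] = (P`_3 + a * P`_2) ^+ 2.
Proof. by rewrite rmorphXn /= mevalD mevalZ !coord_eval. Qed.

Lemma jq_w_num_eval P :
  (jq_w_num s).@[tnth P] = 2%:R * s * (P`_0 * P`_3) ^+ 2.
Proof. by rewrite mevalZ rmorphXn /= mevalM !coord_eval. Qed.

Lemma jq_w_den_eval P :
  (jq_w_den a).@[tnth P] = (P`_3 ^+ 2 + a * P`_0 ^+ 2) ^+ 2.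
Proof. by rewrite rmorphXn /= mevalD mevalZ !rmorphXn /= !coord_eval. Qed.

Lemma reduced_den_neq0 : ~ in_ideal eps delta reduced_den.
Proof.
move=> /(in_ideal_eval (jq_zero_on_curve eps delta)) /eqP.
by rewrite reduced_den_eval /= expr0n /= mulr0 addr0 expr1n oner_eq0.
Qed.

Definition reduced_w : ratfun eps delta :=
  RatFun reduced_homog reduced_den_neq0.

Lemma jq_w_reduced : ratfun_eq (jq_w eps delta a s) reduced_w.
Proof.
exists (- (2%:R * s * a) *: (cX F ^+ 2 * (2%:R *: cZ F ^+ 2
   + a *: (cX F ^+ 2 + cT F * cZ F)))), 0.
rewrite /= /jq_w_num /jq_w_den /reduced_num /reduced_den.
rewrite -!mul_mpolyC !(mpolyCM, mpolyCN); ring.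
Qed.

(** At a point with Z = 0 both forms defining w vanish, so evaluation alone
    does not determine the value of w there.  The arc is a parametrization of
    the curve through such a point, with X / T as parameter; its second
    coordinate is the Taylor expansion of Y, a multiple of
    sqrt (1 + 2 (delta / eps) t^2 + t^4 / eps), up to t^4.  This precision is
    enough because the denominator (Z^2 + a X^2)^2 vanishes to order 4. *)
Definition arc P : 4.-tuple {poly F} :=
  [tuple P`_2 *: 'X;
         P`_1 *: (1 + (delta / eps) *: 'X^2
           + ((eps^-1 - (delta / eps) ^+ 2) / 2%:R) *: 'X^4);
         (P`_2)%:P; P`_2 *: 'X^2].

Definition jet P : {mpoly F[4]} -> {poly F} := mmap (@polyC F) (tnth (arc P)).

Lemma jet_coord P :
  (jet P (cX F) = P`_2 *: 'X) * (jet P (cY F) = (arc P)`_1)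
  * (jet P (cT F) = (P`_2)%:P) * (jet P (cZ F) = P`_2 *: 'X^2).
Proof. by rewrite /jet !mmapX !mmap1U !(tnth_nth 0) !inordK. Qed.

Lemma jet_at0 P q : on_curve eps delta P -> P`_3 = 0 ->
  (jet P q)`_0 = q.@[tnth P].
Proof.
move=> /and3P [_ /eqP hX _] z0.
have x0 : P`_0 = 0 by apply/eqP; rewrite -sqrf_eq0 hX z0 mulr0.
rewrite -horner_coef0 /jet /meval /mmap horner_sum; apply: eq_bigr => m _.
rewrite hornerM hornerC /mmap1 horner_prod; congr (_ * _).
apply: eq_bigr => i _; rewrite horner_exp; congr (_ ^+ _).
case: i => [[|[|[|[|i]]]] hi] //; rewrite !(tnth_nth 0) /= ?x0 ?z0;
  by rewrite !(hornerE, hornerXn, expr0n) /= ?(mulr0, addr0, mulr1).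
Qed.

HB.instance Definition _ P := GRing.RMorphism.on (jet P).

Lemma jetZ P c q : jet P (c *: q) = c *: jet P q.
Proof. by rewrite /jet mmapZ mul_polyC. Qed.

(** The arc satisfies X^2 = TZ exactly and the other equation up to t^5: the
    coefficients of Y are chosen so that eps (2 c + (delta / eps)^2) = 1. *)
Lemma jet_ideal P q : on_curve eps delta P -> P`_3 = 0 ->
  in_ideal eps delta q -> exists r, jet P q = 'X^5 * r.
Proof.
move=> /and3P [_ /eqP hX /eqP hY] z0 [u [v ->]].
have e0 : eps != 0 by rewrite -sqr_a expf_neq0.
have x0 : P`_0 = 0 by apply/eqP; rewrite -sqrf_eq0 hX z0 mulr0.
rewrite x0 z0 !expr0n /= mulr0 !addr0 in hY.
rewrite !(rmorphD, rmorphM, rmorphN, rmorphXn) /= !jetZ.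
rewrite !(rmorphD, rmorphM, rmorphN, rmorphXn) /= !jet_coord /=.
set d := delta / eps; set c := _ / 2%:R.
have hd : delta = eps * d by rewrite /d mulrC divfK.
have hc : 1 = eps * (2%:R * c + d ^+ 2).
  by rewrite /c /d; field; rewrite two_neq0 e0.
clearbody d c.
have hcP : 1 = eps%:P * (2%:R * c%:P + d%:P ^+ 2) :> {poly F}.
  have := congr1 polyC hc.
  by rewrite !(rmorphM, rmorphD, rmorphXn, rmorph_nat) rmorph1.
have hYP : (P`_1)%:P ^+ 2 = eps%:P * (P`_2)%:P ^+ 2 :> {poly F}.
  by rewrite -rmorphXn hY rmorphM rmorphXn.
exists (jet P v * (eps%:P * (P`_2)%:P ^+ 2
         * (2%:R * d%:P * c%:P * 'X + c%:P ^+ 2 * 'X^3))).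
rewrite -!mul_polyC hd !(polyCM, polyC_natr) /=.
(* The coefficient of Z^2 is 1, written as hcP to cancel the t^4 terms. *)
have -> : (P`_2)%:P * 'X^2 * ((P`_2)%:P * 'X^2)
    = (P`_2)%:P ^+ 2 * (eps%:P * (2%:R * c%:P + d%:P ^+ 2)) * 'X^4 :> {poly F}.
  by rewrite -hcP; ring.
by ring: hYP.
Qed.

(** Along the arc the numerator of w has order 6 and its denominator order 4, so
    the numerator of any fraction equal to w vanishes at the point. *)
Lemma jq_w_at_infinity P r : on_curve eps delta P -> P`_3 = 0 ->
  regular_value (jq_w eps delta a s) P r -> r = 0.
Proof.
move=> cP z0 [g [/(jet_ideal cP z0) [q hq] _ ->]].
suff -> : (rf_num g).@[tnth P] = 0 by rewrite mul0r.
have T0 : P`_2 != 0.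
  by apply/eqP => t0; apply: (on_curve_TZ cP t0 z0).
move: hq; rewrite rmorphB !rmorphM /= /jq_w_num /jq_w_den jetZ.
rewrite !(rmorphD, rmorphM, rmorphXn) /= jetZ !rmorphXn /= !jet_coord.
rewrite -!mul_polyC; set T := (P`_2)%:P; set N := jet P (rf_num g);
set D := jet P (rf_den g).
move=> hq.
(* The relation between the two fractions, divided by t^4. *)
have {hq} hX : N * (T ^+ 2 * 'X^2 + a%:P * T ^+ 2) ^+ 2
    = 'X * ((2%:R * s)%:P * T ^+ 4 * 'X * D - q).
  apply/eqP; rewrite -subr_eq0; have X4 : 'X^4 != 0 :> {poly F}.
    by rewrite expf_neq0 ?polyX_eq0.
  rewrite -(mulrI_eq0 _ (mulfI X4)); apply/eqP.
  apply: (@etrans _ _ ('X^5 * q - 'X^5 * q)); last by rewrite subrr.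
  by rewrite -{2}hq; ring.
have /eqP := congr1 (fun p : {poly F} => p.[0]) hX.
rewrite !(hornerE, hornerXn, expr0n) /= mulr0 add0r.
rewrite horner_coef0 (jet_at0 _ cP z0).
by rewrite !(mulf_eq0, expf_eq0) (negPf a_neq0) (negPf T0) !orbF => /eqP.
Qed.

(** Whichever fraction is chosen to express w near P, its value at P is
    the same: away from Z = 0 by cross-multiplication, since the ideal of the
    curve vanishes at P. *)
Lemma regular_valueE P r : on_curve eps delta P ->
  regular_value (jq_w eps delta a s) P r ->
  (w_coords P).2 != 0 /\ (w_coords P).1 = r * (w_coords P).2.
Proof.
move=> cP hr; have nTZ := on_curve_TZ cP.
have /and3P [_ /eqP hX _] := cP; rewrite /w_coords /=.
have [z0|z_neq0] := eqVneq P`_3 0.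
  have t_neq0 : P`_2 != 0 by apply/eqP => /nTZ /(_ z0).
  rewrite (jq_w_at_infinity cP z0 hr) hX z0 mulr0 mulr0 mul0r.
  by rewrite add0r expf_neq0 ?mulf_neq0.
case: hr => g [/(in_ideal_eval cP) + dg0 ->].
rewrite mevalB mevalM /= jq_w_num_eval [X in _ - X]mevalM jq_w_den_eval.
set N := (rf_num g).@[_]; set D := (rf_den g).@[_] in dg0 * => hq.
have {}hq : 2%:R * s * P`_0 ^+ 2 * D = N * (P`_3 + a * P`_2) ^+ 2.
  apply/eqP; rewrite -subr_eq0 -(mulrI_eq0 _ (mulfI z_neq0)).
  rewrite -(mulrI_eq0 _ (mulfI z_neq0)) -[X in _ == X]hq; apply/eqP.
  by ring: hX.
split; last by rewrite [RHS]mulrAC -hq mulfK.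
apply/eqP => v0; move: hq; rewrite v0 mulr0 => /eqP.
rewrite hX !mulf_eq0 (negPf two_neq0) (negPf s_neq0) (negPf dg0) /=.
rewrite (negPf z_neq0) !orbF => /eqP t0.
by move/eqP: v0; rewrite t0 mulr0 addr0 expf_eq0 (negPf z_neq0).
Qed.

Lemma w_coords_neq0 P : on_curve eps delta P ->
  (w_coords P).2 = 0 -> (w_coords P).1 != 0.
Proof.
move=> cP /eqP; have nTZ := on_curve_TZ cP; have /and3P [_ /eqP hX _] := cP.
rewrite /w_coords /= expf_eq0 /= => /eqP v0.
rewrite hX !mulf_eq0 (negPf two_neq0) (negPf s_neq0) /=.
apply/negP => /orP [] /eqP h; move: v0; rewrite h.
  by rewrite mulr0 addr0; apply: nTZ.
rewrite add0r => /eqP; rewrite mulf_eq0 (negPf a_neq0) => /eqP t0; exact: nTZ.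
Qed.

Lemma P1_value_jq_w P : on_curve eps delta P ->
  P1_eq (P1_value (jq_w eps delta a s) P) (w_coords P).
Proof.
move=> cP; rewrite /P1_value; case: pselect => [h|nreg].
  case: (cid h) => r /(regular_valueE cP) [v0 hw] /=.
  exists (w_coords P).2^-1; first by rewrite invr_eq0.
  by rewrite hw mulrCA mulVf ?mulr1.
have [v0|v_neq0] := eqVneq (w_coords P).2 0.
  exists (w_coords P).1^-1; first by rewrite invr_eq0 w_coords_neq0.
  by rewrite v0 mulr0 mulVf ?w_coords_neq0.
case: nreg; exists ((w_coords P).1 / (w_coords P).2), reduced_w.
split; first exact: jq_w_reduced; first by rewrite reduced_den_eval.
by rewrite reduced_num_eval reduced_den_eval.
Qed.

Lemma jq_w_even : ratfun_even (jq_w eps delta a s).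
Proof.
have hX : opp_subst (cX F) = - cX F by rewrite /opp_subst comp_mpolyXU inordK.
have hZ : opp_subst (cZ F) = cZ F by rewrite /opp_subst comp_mpolyXU inordK.
exists 0, 0; rewrite /= /jq_w_num /jq_w_den.
have hS c (q : {mpoly F[4]}) : opp_subst (c *: q) = c *: opp_subst q.
  exact: comp_mpolyZ.
have hD : {morph @opp_subst F : p q / p + q} by exact: comp_mpolyD.
have hM : {morph @opp_subst F : p q / p * q} by exact: rmorphM.
by rewrite !expr2 !(hS, hD, hM) hX hZ !(mulNr, mulrN) !opprK; ring.
Qed.

End Value.

(** * Doubling and differential addition *)

Section Arithmetic.
Variables (F : fieldType) (eps delta a s : F).
Hypotheses (two_neq0 : 2%:R != 0 :> F)
           (nonsing : eps * (delta ^+ 2 - eps) != 0)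
           (sqr_a : a ^+ 2 = eps) (sqr_s : s ^+ 2 = 2%:R * a * (a - delta)).
Implicit Types P Q : 4.-tuple F.

Local Notation W := (w_coords a s).
Local Notation add := (jq_add eps delta).

Lemma a_neq0 : a != 0.
Proof.
by apply/eqP => a0; move: nonsing; rewrite -sqr_a a0 expr0n /= mul0r eqxx.
Qed.

(** If s = 0 then a = delta, which makes the curve singular. *)
Lemma s_neq0 : s != 0.
Proof.
apply/eqP => s0; move/eqP: sqr_s; rewrite s0 expr0n /= eq_sym.
rewrite !mulf_eq0 (negPf two_neq0) (negPf a_neq0) subr_eq0 /= => /eqP ad.
by move: nonsing; rewrite -sqr_a ad subrr mulr0 eqxx.
Qed.

Definition montgomery_param : F := (2%:R * a + s) ^+ 2 / (2%:R * a * s).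

(** Clears the denominators of the parameter: W has a factor s, so with this
    form the doubling formula becomes a polynomial identity. *)
Lemma montgomery_param_s : montgomery_param * s = 2%:R * s + 3%:R * a - delta.
Proof.
have a0 := a_neq0; have s0 := s_neq0.
have h : (2%:R * a + s) ^+ 2 = 2%:R * a * (2%:R * s + 3%:R * a - delta).
  by ring: sqr_s.
by rewrite /montgomery_param h; field; rewrite a0 s0 two_neq0.
Qed.

(** Both sides agree exactly, without rescaling: with p = TZ and
    N = Z^2 + eps T^2, one has W = 2 s p and V = N + 2 a p; the sum of P with
    itself has first form 8 s p (N + 2 delta p) (N - 2 a p) (N + 2 a p), in which
    (N + 2 delta p) (N - 2 a p) is (W + V)^2 - e W V, and the root of its second
    form is V^2 - W^2. *)
Lemma w_coords_double P : on_curve eps delta P ->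
  W (add P P) =
  (4%:R * (W P).1 * (W P).2
     * (((W P).1 + (W P).2) ^+ 2 - montgomery_param * (W P).1 * (W P).2),
   ((W P).1 ^+ 2 - (W P).2 ^+ 2) ^+ 2).
Proof.
move=> cP; have := add_laws_complete two_neq0 nonsing cP cP.
have /and3P [_ /eqP hX /eqP hY] := cP.
rewrite hX -sqr_a in hY; rewrite /jq_add; case: eqP => /= [l1|_ _].
  (* The second law vanishes identically on the diagonal, so the first
     one does not. *)
  case=> //; apply/eqP; rewrite /add_law2 -sqr_a mk4_eq0 !sqrf_eq0.
  by apply/and4P; split; apply/eqP; ring: hX hY.
rewrite /w_coords /add_law1 /= -sqr_a.
set X := P`_0 in hX hY *; set Y := P`_1 in hX hY *.
set T := P`_2 in hX hY *; set Z := P`_3 in hX hY *.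
have -> : montgomery_param * (2%:R * s * X ^+ 2)
    = 2%:R * (2%:R * s + 3%:R * a - delta) * X ^+ 2.
  by rewrite -montgomery_param_s; ring.
by congr (_, _); ring: hX hY sqr_s.
Qed.

(** The two addition laws give the x-coordinate X / Z of P + Q as
    law1_x / law1_z and as law2_x / law2_z. *)
Definition law1_x P Q := P`_0 * Q`_1 + Q`_0 * P`_1.
Definition law1_z P Q := P`_3 * Q`_3 - eps * P`_2 * Q`_2.
Definition law2_x P Q := P`_2 * Q`_3 - Q`_2 * P`_3.
Definition law2_z P Q := P`_0 * Q`_1 - Q`_0 * P`_1.

(** The coordinates of w at a point with (X : T : Z) = (x z : x^2 : z^2). *)
Definition w_ratio (x z : F) : F * F :=
  (2%:R * s * (x * z) ^+ 2, (z ^+ 2 + a * x ^+ 2) ^+ 2).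

(** The first law is used unless it is identically zero; when law1_x and law1_z
    vanish the Y-coordinate of the first law does so too, since no point of the
    curve has T = Z = 0. *)
Lemma w_coords_add P Q : on_curve eps delta P -> on_curve eps delta Q ->
  if (law1_x P Q == 0) && (law1_z P Q == 0)
  then W (add P Q) = w_ratio (law2_x P Q) (law2_z P Q)
  else W (add P Q) = w_ratio (law1_x P Q) (law1_z P Q).
Proof.
move=> cP cQ; have := jq_add_on_curve two_neq0 nonsing cP cQ.
rewrite /jq_add; case: eqP => /= [l1 _|_ c1].
  move/eqP: l1; rewrite /add_law1 mk4_eq0 !sqrf_eq0.
  by move=> /and4P [_ _ h1 h2]; rewrite /law1_x h1 /law1_z h2.
case: ifP => // /andP [/eqP h1 /eqP h2]; exfalso.
by apply: (on_curve_TZ c1); rewrite /add_law1 /= -?/(law1_x P Q) -?/(law1_z P Q)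
   ?h1 ?h2 expr0n.
Qed.

Lemma jq_opp_on_curve P : on_curve eps delta P -> on_curve eps delta (jq_opp P).
Proof.
move=> /and3P [P0 hX hY]; apply/and3P; split; rewrite //= ?sqrrN //.
apply: contra P0 => /eqP /(congr1 val) [/eqP].
rewrite oppr_eq0 => /eqP x0 y0 t0 z0; apply/eqP/eq_from_tnth.
by move=> [[|[|[|[|i]]]] hi]; rewrite ?(tnth_nth 0).
Qed.

Section TwoPoints.
Variables P Q : 4.-tuple F.
Hypotheses (cP : on_curve eps delta P) (cQ : on_curve eps delta Q).

(** Both ratios compute the same x-coordinate. *)
Lemma law_x_z : law1_x P Q * law2_z P Q = law2_x P Q * law1_z P Q.
Proof.
have /and3P [_ /eqP hX1 /eqP hY1] := cP; have /and3P [_ /eqP hX2 /eqP hY2] := cQ.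
rewrite hX1 in hY1; rewrite hX2 in hY2.
by rewrite /law1_x /law1_z /law2_x /law2_z; ring: hX1 hY1 hX2 hY2.
Qed.

Lemma w_difference :
  (W P).1 * (W Q).2 - (W Q).1 * (W P).2
  = 2%:R * s * law2_x P Q * law1_z P Q.
Proof.
have /and3P [_ /eqP hX1 _] := cP; have /and3P [_ /eqP hX2 _] := cQ.
by rewrite /law1_z /law2_x /w_coords /= -sqr_a; ring: hX1 hX2.
Qed.

(** With p = TZ and N = Z^2 + eps T^2 at each point, the right-hand side is
    N1 N2 + 2 a (p1 N2 + p2 N1) - 4 a^2 p1 p2 + 8 a delta p1 p2.  It differs from
    V1 V2 by 8 a (a - delta) p1 p2 = 4 s^2 p1 p2 = W1 W2; this is the
    reason for the factor s in w. *)
Lemma w_product :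
  (W P).2 * (W Q).2 - (W P).1 * (W Q).1
  = law1_z P Q ^+ 2 + a * (law1_x P Q ^+ 2 + law2_z P Q ^+ 2)
    + a ^+ 2 * law2_x P Q ^+ 2.
Proof.
have /and3P [_ /eqP hX1 /eqP hY1] := cP; have /and3P [_ /eqP hX2 /eqP hY2] := cQ.
rewrite hX1 in hY1; rewrite hX2 in hY2.
rewrite /law1_x /law1_z /law2_x /law2_z /w_coords /=.
by rewrite -sqr_a in hY1 hY2 *; ring: hX1 hY1 hX2 hY2 sqr_s.
Qed.

(** Changing the sign of P exchanges law1_x and law2_z, up to sign. *)
Lemma w_coords_sub :
  W (add Q (jq_opp P)) =
  if (law2_z P Q == 0) && (law1_z P Q == 0)
  then w_ratio (law2_x P Q) (law1_x P Q)
  else w_ratio (law2_z P Q) (law1_z P Q).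
Proof.
have := w_coords_add cQ (jq_opp_on_curve cP).
have -> : law1_x Q (jq_opp P) = - law2_z P Q by rewrite /law1_x /law2_z /=; ring.
have -> : law1_z Q (jq_opp P) = law1_z P Q by rewrite /law1_z /=; ring.
have -> : law2_x Q (jq_opp P) = - law2_x P Q by rewrite /law2_x /=; ring.
have -> : law2_z Q (jq_opp P) = law1_x P Q by rewrite /law2_z /law1_x /=; ring.
by rewrite oppr_eq0 /w_ratio !mulNr !sqrrN; case: ifP.
Qed.

(** For b = law1_z nonzero both points P + Q and Q - P come from the first law,
    and multiplying their coordinates gives b^4 times the squares of the two
    quantities above.  The case b = 0 is where P + Q or Q - P has Z = 0 or
    comes from the second law. *)
Lemma w_coords_dadd (W0 := W (add Q (jq_opp P))) :
  W0.1 * W0.2 != 0 ->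
  P1_eq (W (add P Q))
    (W0.2 * ((W P).1 * (W Q).2 - (W Q).1 * (W P).2) ^+ 2,
     W0.1 * ((W P).1 * (W Q).1 - (W P).2 * (W Q).2) ^+ 2).
Proof.
have -> : ((W P).1 * (W Q).1 - (W P).2 * (W Q).2) ^+ 2
    = ((W P).2 * (W Q).2 - (W P).1 * (W Q).1) ^+ 2 by ring.
rewrite {}/W0 w_difference w_product w_coords_sub.
have := w_coords_add cP cQ; have := law_x_z.
set A := law1_x P Q; set b := law1_z P Q; set c := law2_x P Q.
set d := law2_z P Q => Ad.
have a0 := a_neq0.
have [b0|b_neq0] := eqVneq b 0; rewrite ?andbF ?andbT.
  rewrite b0 mulr0 in Ad *.
  (* Here Q - P has Z = 0 under either law, against w(Q - P) <> 0. *)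
  have [A0|A_neq0] := eqVneq A 0.
    by case: ifP => _ _; rewrite /w_ratio /= A0 ?mulr0 expr0n mulr0 mul0r eqxx.
  (* Now P + Q has Z = 0, hence w(P + Q) = 0 = W1 V2 - W2 V1. *)
  have d0 : d = 0.
    by apply/eqP; move/eqP: Ad; rewrite mulf_eq0 (negPf A_neq0).
  rewrite d0 eqxx => -> /=; rewrite /w_ratio expr0n /= addr0 add0r !mulr0.
  have -> : a * A ^+ 2 + a ^+ 2 * c ^+ 2 = a * (A ^+ 2 + a * c ^+ 2) by ring.
  set w := 2%:R * s * (c * A) ^+ 2; set v := A ^+ 2 + a * c ^+ 2.
  rewrite mulf_eq0 expf_eq0 negb_or /= => /andP [w0 v0].
  exists ((a * A ^+ 2) ^+ 2 / (w * (a * v) ^+ 2)).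
    by do ![exact: w0 | assumption | apply: expf_neq0 | apply: invr_neq0
           | apply: mulf_neq0].
  by congr (_, _) => /=; field; rewrite w0 v0 a0.
move=> ->; rewrite /w_ratio /=.
set w := 2%:R * s * (d * b) ^+ 2; set v := b ^+ 2 + a * d ^+ 2 => h.
have {h} [w0 v0] : w != 0 /\ v != 0.
  by move: h; rewrite mulf_eq0 expf_eq0 negb_or /= => /andP [].
exists (b ^+ 4 / (w * v ^+ 2)).
  by do ![exact: w0 | assumption | apply: expf_neq0 | apply: invr_neq0
         | apply: mulf_neq0].
have hw : w * (A * b) ^+ 2 = b ^+ 4 * (2%:R * s * c ^+ 2 * b ^+ 2).
  transitivity (2%:R * s * b ^+ 4 * (A * d) ^+ 2); first by rewrite /w; ring.
  by rewrite Ad; ring.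
have hv : v * (b ^+ 2 + a * A ^+ 2)
    = b ^+ 2 * (b ^+ 2 + a * (A ^+ 2 + d ^+ 2) + a ^+ 2 * c ^+ 2).
  transitivity (b ^+ 4 + a * b ^+ 2 * (A ^+ 2 + d ^+ 2) + a ^+ 2 * (A * d) ^+ 2).
    by rewrite /v; ring.
  by rewrite Ad; ring.
congr (_, _) => /=.
  apply: (mulfI w0); rewrite mulrCA hw; field.
  by rewrite w0 v0.
apply: (mulfI (expf_neq0 2 v0)); rewrite -exprMn hv; field.
by rewrite w0 v0.
Qed.

End TwoPoints.
End Arithmetic.

(* a is the fixed square root of eps, s that of 2 a (a - delta). *)
Theorem proposition7 (F : finFieldType) (p : nat)
    (char_F : p \in [pchar F]) (odd_p : odd p)
    (eps delta : F) (nonsing : eps * (delta ^+ 2 - eps) != 0)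
    (a : F) (sqr_a : a ^+ 2 = eps)
    (chi_1 : quad_char (2%:R * a * (a - delta)) = 1)
    (s : F) (sqr_s : s ^+ 2 = 2%:R * a * (a - delta)) :
  inverted_Montgomery_like (jq_w eps delta a s)
    ((2%:R * a + s) ^+ 2 / (2%:R * a * s)).
Proof.
have two_neq0 : 2%:R != 0 :> F.
  rewrite -(dvdn_pcharf char_F) dvdn_prime2 ?(pcharf_prime char_F) //.
  by apply: contraL odd_p => /eqP ->.
have a0 := a_neq0 nonsing sqr_a.
have s0 := s_neq0 two_neq0 nonsing sqr_a sqr_s.
split=> [|P1 P2 c1 c2]; first exact: jq_w_even.
have val := P1_value_jq_w two_neq0 a0 s0 sqr_a (delta := delta).
have c12 := jq_add_on_curve two_neq0 nonsing c1 c2.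
have c11 := jq_add_on_curve two_neq0 nonsing c1 c1.
have c21 := jq_add_on_curve two_neq0 nonsing c2
  (jq_opp_on_curve c1).
move: (val _ c21) (val _ c1) (val _ c2) (val _ c12) (val _ c11).
move: (w_coords_dadd two_neq0 nonsing sqr_a sqr_s c1 c2).
rewrite (w_coords_double two_neq0 nonsing sqr_a sqr_s c1) /montgomery_param.
move: (w_coords a s _) (w_coords a s P1) (w_coords a s P2) (w_coords a s _).
set e := _ / _ => w0 w1 w2 w3 dadd.
case: (P1_value _ _) => W0 Z0; case: (P1_value _ _) => W1 Z1.
case: (P1_value _ _) => W2 Z2; case: (P1_value _ _) => W3 Z3.
case: (P1_value _ _) => W4 Z4.
move=> [k0 k0_neq0 [-> ->]] [k1 k1_neq0 [-> ->]] [k2 k2_neq0 [-> ->]].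
move=> [k3 k3_neq0 [-> ->]] [k4 k4_neq0 [-> ->]] h.
split.
  (* The doubling forms are homogeneous of degree 4 in (W1, V1). *)
  exists (k4 / k1 ^+ 4); first by rewrite mulf_neq0 ?invr_neq0 ?expf_neq0.
  by congr (_, _) => /=; field.
case: dadd => [|k k_neq0 ->] /=.
  by apply: contraNneq h => h; rewrite mulrACA h mulr0.
(* Degree 1 in the coordinates at P2 - P1, degree 2 in those at P1 and P2. *)
exists (k3 * k / (k0 * k1 ^+ 2 * k2 ^+ 2)).
  by rewrite !mulf_neq0 ?invr_neq0 ?mulf_neq0 ?expf_neq0.
by congr (_, _) => /=; field; rewrite k0_neq0 k1_neq0 k2_neq0.
Qed.
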